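(* For non-negative integers $n$ and $m$, \[ \sum_{k=0}^n (-1)^{mk} \binom {n+k}{k} \frac{F_{m(n+1-k)}}{L_m^k} = F_m L_m^{n} \Bigg ( 1 + 2\sum_{k=0}^{n-1} \frac{(-1)^{m(k+1)}}{L_m^{2(k+1)}} \binom {2k+1}{k} \Bigg ) \] and \[ \sum_{k=0}^n (-1)^{mk} \binom {n+k}{k} \frac{L_{m(n+1-k)}}{L_m^k} = L_m^{n+1}. \]
   Context: $F_j$ and $L_j$ denote the Fibonacci and Lucas numbers: $F_0=0,F_1=1$, $L_0=2,L_1=1$, both satisfying $X_j=X_{j-1}+X_{j-2}$. *)

(* Defs.v *)
From mathcomp Require Import all_boot all_order all_algebra.
Set Implicit Arguments.
Unset Strict Implicit.
Unset Printing Implicit Defensive.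

Fixpoint fib (n : nat) : nat :=
  match n with
  | 0 => 0
  | n1.+1 => match n1 with 0 => 1 | n2.+1 => fib n1 + fib n2 end
  end.

Fixpoint lucas (n : nat) : nat :=
  match n with
  | 0 => 2
  | n1.+1 => match n1 with 0 => 1 | n2.+1 => lucas n1 + lucas n2 end
  end.

(* Main.v *)
Require Import Defs.
From mathcomp Require Import all_boot all_order all_algebra.
From mathcomp Require Import zify ring.
Import Order.TTheory GRing.Theory Num.Theory.
Local Open Scope ring_scope.

Set Implicit Arguments.
Unset Strict Implicit.

(** The sequences [W j = F_(mj)] and [W j = L_(mj)] both satisfy
    [W (j+2) = s W (j+1) - p W j] with [s = L_m] and [p = (-1)^m]. For any such
    [W], put [q = p / s] and [T n = \sum_(k <= n) 'C(n+k, k) q^k W (n+1-k)].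
    Pascal's rule makes [T (n+1) - s T n] telescope in [k] to
    ['C(2n+1, n) q^(n+1) (2 W 1 - s W 0)]. The last factor is [2 F_m] in the
    Fibonacci case and vanishes in the Lucas case; induction on [n] gives both
    identities. *)

Lemma lucas_gt0 (m : nat) : (0 < lucas m)%N.
Proof.
suff: (0 < lucas m)%N && (0 < lucas m.+1)%N by case/andP.
elim: m => [//|m /andP[h1 h2]]; rewrite h2 /=.
by change (0 < lucas m.+1 + lucas m)%N; rewrite addn_gt0 h2.
Qed.

(** Two-step induction on [m] with [r] kept general. Leaving [X] arbitrary covers Fibonacci and
    Lucas numbers at once. *)
Lemma lucas_mul_shift (R : comNzRingType) (X : nat -> R) :
  (forall r, X r.+2 = X r.+1 + X r) ->
  forall m r, (lucas m)%:R * X (r + m)%N = X (r + 2 * m)%N + (-1) ^+ m * X r.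
Proof.
move=> recX m.
suff: (forall r, (lucas m)%:R * X (r + m)%N
                 = X (r + 2 * m)%N + (-1) ^+ m * X r) /\
      (forall r, (lucas m.+1)%:R * X (r + m.+1)%N
                 = X (r + 2 * m.+1)%N + (-1) ^+ m.+1 * X r) by case.
elim: m => [|m [IH0 IH1]]; split=> // r.
- by rewrite muln0 !addn0 expr0 /=; ring.
- by rewrite muln1 addn1 addn2 recX expr1 /=; ring.
have -> : lucas m.+2 = (lucas m.+1 + lucas m)%N by [].
(* These shifts of [r] give both instances the common factor [X (r + m.+2)], so their sum has the
   coefficient [lucas m.+2]. *)
have e0 := IH0 r.+2; have e1 := IH1 r.+1.
have i0 : (r.+2 + m = r + m.+2)%N by lia.
have i1 : (r.+1 + m.+1 = r + m.+2)%N by lia.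
have i2 : (r + 2 * m.+2 = (r + 2 * m).+4)%N by lia.
have i3 : (r.+2 + 2 * m = (r + 2 * m).+2)%N by lia.
have i4 : (r.+1 + 2 * m.+1 = (r + 2 * m).+3)%N by lia.
rewrite i0 i3 in e0; rewrite i1 i4 in e1.
rewrite natrD mulrDl e0 e1 i2 (recX (r + 2 * m).+2) (recX r) !exprS; ring.
Qed.

Lemma lucas_multiples_rec (R : comNzRingType) (X : nat -> R) (m : nat) :
  (forall r, X r.+2 = X r.+1 + X r) ->
  forall j, X (m * j.+2)%N =
    (lucas m)%:R * X (m * j.+1)%N - (-1) ^+ m * X (m * j)%N.
Proof.
move=> recX j.
have -> : (m * j.+1 = m * j + m)%N by lia.
have -> : (m * j.+2 = m * j + 2 * m)%N by lia.
by rewrite lucas_mul_shift //; ring.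
Qed.

Section BinomialLucasSum.

Variables (R : comNzRingType) (s q : R) (W : nat -> R).
Hypothesis recW : forall j, W j.+2 = s * W j.+1 - s * q * W j.

Definition binom_conv (n : nat) : R :=
  \sum_(0 <= k < n.+1) 'C(n + k, k)%:R * q ^+ k * W (n + 1 - k)%N.

(** The subtracted term is the boundary of the telescoping. Expanding the next summand by Pascal and
    [recW], one part cancels this boundary, one extends the sum on the right, and the rest is the
    boundary for [j.+1]. *)
Lemma binom_conv_partial (n j : nat) : (j <= n)%N ->
  \sum_(0 <= k < j.+1) 'C(n.+1 + k, k)%:R * q ^+ k * W (n.+1 + 1 - k)%N
  = s * (\sum_(0 <= k < j.+1) 'C(n + k, k)%:R * q ^+ k * W (n + 1 - k)%N)
    - s * q ^+ j.+1 * 'C(n.+1 + j, j)%:R * W (n - j)%N.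
Proof.
elim: j => [_|j IH lt_jn].
  by rewrite !big_nat1 !bin0 !subn0 !addn1 recW expr0 expr1; ring.
rewrite big_nat_recr //= IH 1?ltnW // [in RHS]big_nat_recr //=.
have -> : (n - j = (n - j.+1).+1)%N by lia.
have -> : (n + 1 - j.+1 = (n - j.+1).+1)%N by lia.
have -> : (n.+1 + 1 - j.+1 = (n - j.+1).+2)%N by lia.
have -> : (n.+1 + j.+1 = (n + j.+1).+1)%N by lia.
have -> : (n.+1 + j = n + j.+1)%N by lia.
by rewrite binS natrD recW !exprS; ring.
Qed.

Lemma binom_convS (n : nat) :
  binom_conv n.+1 = s * binom_conv n
    + 'C(2 * n + 1, n)%:R * q ^+ n.+1 * (2 * W 1%N - s * W 0%N).
Proof.
rewrite /binom_conv big_nat_recr //= binom_conv_partial // subnn.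
have -> : (n.+1 + 1 - n.+1 = 1)%N by lia.
have -> : (n.+1 + n.+1 = (2 * n + 1).+1)%N by lia.
have -> : (n.+1 + n = 2 * n + 1)%N by lia.
(* The summand [k = n.+1] carries a central binomial; by symmetry it is twice the boundary
   coefficient, whence [2 * W 1 - s * W 0]. *)
have -> : 'C((2 * n + 1).+1, n.+1) = ('C(2 * n + 1, n) + 'C(2 * n + 1, n))%N.
  rewrite binS; congr (_ + _)%N.
  have le_n : (n <= 2 * n + 1)%N by lia.
  by rewrite -(bin_sub le_n); congr binomial; lia.
by rewrite natrD; ring.
Qed.

End BinomialLucasSum.

(** Dividing the step recurrence by [s ^+ n.+1] turns it into a plain sum; with [q = p / s] this
    doubles the exponent of [s] in the denominators. *)
Lemma binom_convE (F : fieldType) (s p : F) (W : nat -> F) (n : nat) :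
  s != 0 -> (forall j, W j.+2 = s * W j.+1 - p * W j) ->
  binom_conv (p / s) W n = s ^+ n * (W 1%N + (2 * W 1%N - s * W 0%N) *
    \sum_(0 <= k < n) p ^+ (k + 1) / s ^+ (2 * (k + 1)) * 'C(2 * k + 1, k)%:R).
Proof.
move=> s0 recW; elim: n => [|n IH].
  rewrite /binom_conv big_nat1 big_geq // addn0 bin0 subn0 expr0; ring.
rewrite (@binom_convS _ s) => [|j]; last first.
  by rewrite recW; congr (_ - _ * _); field.
rewrite IH big_nat_recr //=; set S := \sum_(_ <= _ < _) _.
have -> : s ^+ (2 * (n + 1)) = (s * s ^+ n) ^+ 2.
  by rewrite -exprS -exprM mulnC addn1.
rewrite !addn1 expr_div_n !exprS expr0.
by field; rewrite s0 expf_neq0.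
Qed.

Lemma binom_conv_sum (m n : nat) (X : nat -> nat) :
  \sum_(0 <= k < n.+1)
      (-1) ^+ (m * k) * 'C(n + k, k)%:R *
      ((X (m * (n + 1 - k))%N)%:R / (lucas m)%:R ^+ k)
  = binom_conv ((-1) ^+ m / (lucas m)%:R) (fun j => (X (m * j)%N)%:R) n :> rat.
Proof.
apply: eq_bigr => k _; rewrite expr_div_n -exprM.
by rewrite !mulrA [(-1) ^+ _ * _]mulrC mulrAC.
Qed.

Theorem theorem14 (n m : nat) :
  \sum_(0 <= k < n.+1)
      (-1) ^+ (m * k) * 'C(n + k, k)%:R *
      ((fib (m * (n + 1 - k)))%:R / (lucas m)%:R ^+ k)
    = (fib m)%:R * (lucas m)%:R ^+ n *
      (1 + 2 * \sum_(0 <= k < n)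
                  ((-1) ^+ (m * (k + 1)) / (lucas m)%:R ^+ (2 * (k + 1))) *
                  'C(2 * k + 1, k)%:R) :> rat
  /\
  \sum_(0 <= k < n.+1)
      (-1) ^+ (m * k) * 'C(n + k, k)%:R *
      ((lucas (m * (n + 1 - k)))%:R / (lucas m)%:R ^+ k)
    = (lucas m)%:R ^+ (n + 1) :> rat.
Proof.
have s0 : (lucas m)%:R != 0 :> rat by rewrite pnatr_eq0 -lt0n lucas_gt0.
have recF r : (fib r.+2)%:R = (fib r.+1)%:R + (fib r)%:R :> rat.
  by rewrite -natrD.
have recL r : (lucas r.+2)%:R = (lucas r.+1)%:R + (lucas r)%:R :> rat.
  by rewrite -natrD.
split; rewrite binom_conv_sum (binom_convE _ s0).
(* Here [W 0 = fib 0 = 0]. *)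
- rewrite muln1 muln0 mulr0 subr0.
  under eq_bigr do rewrite -exprM.
  by ring.
- exact: lucas_multiples_rec recF.
(* Here [W 0 = lucas 0 = 2] and [W 1 = s], so [2 * W 1 - s * W 0 = 0] and only [s ^+ n * s]
   remains. *)
- by rewrite muln1 muln0 addn1 exprS /=; ring.
- exact: lucas_multiples_rec recL.
Qed.
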